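(* Let $(M,g)$ be a Lorentzian manifold of dimension $n\ge 3$ with a null congruence $c$, and let $k$ be a non-vanishing section of $c$. Let $r\ge 1$ and $-r\le s\le r-1$. If $T$ is a covariant rank $r$ tensor field with $\mathrm{bo}_c(T)=s$ on $M$ and $Q\in\mathcal{B}_r^{-s-1}(M)$, then $$(\nabla_a T_{c_1\cdots c_r})Q^{c_1\cdots c_r}=\nabla_a k^b\,\langle T|k|Q\rangle_b,$$ meaning that for every vector field $X$ on $M$ (for which $X^a\nabla_a k^b$ lies in $c^\perp$ at each point) $$X^a(\nabla_a T_{c_1\cdots c_r})Q^{c_1\cdots c_r}=\pi(X^a\nabla_a k^b)\,\langle T|k|Q\rangle_b .$$ Furthermore, if $\mathrm{bo}_c(Q)<-s-1$ on $M$, then $(\nabla_a T_{c_1\cdots c_r})Q^{c_1\cdots c_r}=0$.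
   Context: Lorentzian metrics have signature $(-,+,\dots,+)$, $\nabla$ is the Levi-Civita connection, and indices are raised and lowered with $g$ (vectors and covectors are identified). A null congruence $c$ (equivalently null line distribution) is a smooth rank-one subbundle of $TM$ whose fibres are null lines; $c^\perp\supset c$ is its orthogonal complement. Boost order: for a null line $c$ in an $n$-dimensional Lorentzian vector space $(V,g)$ take a null frame $\{e_0,e_1,e_i\}=\{k,l,m_i\}$ ($2\le i\le n-1$) with $0\ne k\in c$, whose only non-zero inner products are $g(k,l)=g(m_i,m_i)=1$. The boost weight of a multi-index $\alpha_1\cdots\alpha_r$ is (number of $0$'s) minus (number of $1$'s). The boost order $\mathrm{bo}_c(T)$ of a non-zero covariant rank $r$ tensor $T$ is the largest boost weight of a multi-index with $T_{\alpha_1\cdots\alpha_r}=T(e_{\alpha_1},\dots,e_{\alpha_r})\neq 0$; it does not depend on the frame chosen. The zero tensor is regarded as having boost order $\le s$ for every $s$. $\mathcal{B}_r^s$ is the space of covariant rank $r$ tensors of boost order $\le s$ along $c$; on a manifold, $\mathcal{B}_r^s(M)$ is the module of sections of the corresponding bundle. ''$\mathrm{bo}_c(T)=s$ on $M$'' means that this holds at every point. Bilinear map: for covariant rank $r$ tensors $T,Q$ put $$\varphi(T,Q)_{ab}=\sum_{i=1}^r\Big(T_{c_1\cdots c_{i-1}\,b\,c_{i+1}\cdots c_r}Q^{c_1\cdots c_{i-1}}{}_a{}^{c_{i+1}\cdots c_r}-T_{c_1\cdots c_{i-1}\,a\,c_{i+1}\cdots c_r}Q^{c_1\cdots c_{i-1}}{}_b{}^{c_{i+1}\cdots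 c_r}\Big).$$ For $0\ne k\in c$, let $l$ be any null vector with $g(k,l)=1$, and for $T\in\mathcal{B}_r^s$, $Q\in\mathcal{B}_r^{-s-1}$ ($-r\le s\le r-1$) define $$\langle T|k|Q\rangle^a=\pi(\varphi(T,Q)^{ab}l_b)\in c^\perp/c,$$ where $\pi:c^\perp\to c^\perp/c$ is the quotient map; here $\varphi(T,Q)^{ab}l_b\in c^\perp$, and the result is independent of the choice of $l$. On manifolds the map is applied pointwise. Indices on $c^\perp/c$ are raised, lowered and contracted with the positive definite inner product induced by $g$. *)

(* Defs.v *)
From HB Require Import structures.
From mathcomp Require Import all_boot all_order all_algebra.
From mathcomp Require Import all_classical all_reals all_analysis.

Set Implicit Arguments.
Unset Strict Implicit.
Unset Printing Implicit Defensive.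

Import Order.TTheory GRing.Theory Num.Theory.
Import numFieldNormedType.Exports.

Local Open Scope classical_set_scope.
Local Open Scope ring_scope.

(** * Tensor algebra on R^n with a Gram matrix

  Vectors are row vectors, with contravariant components [v 0 a].  A covariant
  rank [r] tensor is the family of its components [T alpha], indexed by the
  multi-indices [alpha : 'I_r -> 'I_n].  [G] is the Gram matrix [g_ab] of a
  bilinear form, so that [invmx G] is [g^ab]. *)

Section PointwiseAlgebra.
Context {R : realType} {n : nat}.
Implicit Types (G E : 'M[R]_n) (u v k l : 'rV[R]_n) (c : {vspace 'rV[R]_n}).

Definition mindex (r : nat) := {ffun 'I_r -> 'I_n}.
Definition ctensor (r : nat) := mindex r -> R.

Definition inner G u v : R := (u *m G *m v^T) 0 0.

Definition lorentzian_form G : Prop :=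
  G^T = G /\
  exists2 E, E \in unitmx &
    E *m G *m E^T = diag_mx (\row_(a < n) (-1) ^+ (a == 0%N :> nat)).

Definition null_line G c : Prop :=
  \dim c = 1%N /\ forall v, v \in c -> inner G v v = 0.

Definition perp G c : set 'rV[R]_n :=
  [set v | forall u, u \in c -> inner G u v = 0].

Definition teval r (T : ctensor r) (v : 'I_r -> 'rV[R]_n) : R :=
  \sum_(alpha : mindex r) T alpha * \prod_(i < r) v i 0 (alpha i).

(** Gram matrix of [{k, l, m_i}]: its entries (0,1), (1,0) and (a,a), [a >= 2],
  are 1 and all the others vanish. *)
Definition null_gram : 'M[R]_n :=
  \matrix_(a < n, b < n) (if (a < 2)%N then (a + b == 1)%N else a == b)%:R.

(** The rows of [E] are the vectors [e_a] of a null frame with [e_0] in [c]. *)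
Definition null_frame G c E : Prop :=
  (forall a : 'I_n, a = 0%N :> nat -> row a E \in c) /\
  E *m G *m E^T = null_gram.

Definition frame_comp r E (T : ctensor r) (alpha : mindex r) : R :=
  teval T (fun i => row (alpha i) E).

Definition boost_weight r (alpha : mindex r) : int :=
  #|[set i | alpha i == 0%N :> nat]|%:Z - #|[set i | alpha i == 1%N :> nat]|%:Z.

(** The boost order does not depend on the null frame, so the weakest reading,
  "in some null frame", is used for [boost_order_le] and [boost_order]. *)
Definition boost_order_le r G c (T : ctensor r) (s : int) : Prop :=
  exists2 E, null_frame G c E &
    forall alpha, frame_comp E T alpha != 0 -> boost_weight alpha <= s.

Definition boost_order r G c (T : ctensor r) (s : int) : Prop :=
  exists2 E, null_frame G c E &
    (exists2 alpha, frame_comp E T alpha != 0 & boost_weight alpha = s) /\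
    (forall alpha, frame_comp E T alpha != 0 -> boost_weight alpha <= s).

(** Covers the zero tensor, which has boost order [<= s] for every [s]. *)
Definition boost_order_lt r G c (T : ctensor r) (t : int) : Prop :=
  exists2 s : int, s < t & boost_order_le G c T s.

(** [T_(c_1 ... c_r) Q^(c_1 ... c_r)] *)
Definition full_contraction r G (T Q : ctensor r) : R :=
  \sum_(alpha : mindex r) \sum_(beta : mindex r)
    T alpha * Q beta * \prod_(j < r) invmx G (alpha j) (beta j).

(** Contraction of all the slots but the [i]-th, in which [T] has the free index
  [a] and [Q] the free (lower) index [b]. *)
Definition partial_contraction r G (i : 'I_r) (T Q : ctensor r)
    (a b : 'I_n) : R :=
  \sum_(alpha : mindex r | alpha i == a) \sum_(beta : mindex r | beta i == b)
    T alpha * Q beta * \prod_(j < r | j != i) invmx G (alpha j) (beta j).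

Definition tensor_phi r G (T Q : ctensor r) : 'M[R]_n :=
  \matrix_(a < n, b < n)
    \sum_(i < r)
      (partial_contraction G i T Q b a - partial_contraction G i T Q a b).

Definition raise2 G (F : 'M[R]_n) : 'M[R]_n := invmx G *m F *m (invmx G)^T.

Definition lower_index G v : 'rV[R]_n := v *m G.

(** Elements of [c^perp / c] are represented as cosets, i.e. sets of vectors. *)
Definition line_coset c u : set 'rV[R]_n := [set v | v - u \in c].

Definition perp_quot G c : set (set 'rV[R]_n) := line_coset c @` perp G c.

(** Inner product induced on [c^perp / c]: on that quotient the value does not
  depend on the representatives. *)
Definition quot_inner G (A B : set 'rV[R]_n) : R := inner G (get A) (get B).

(** [<T|k|Q>^a = pi (phi(T,Q)^(ab) l_b)], with [l] any null vector such that
  [g(k,l) = 1]. *)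
Definition bracket r G c k (T Q : ctensor r) : set 'rV[R]_n :=
  let l := get [set l | inner G l l = 0 /\ inner G k l = 1] in
  line_coset c
    (\row_(a < n) \sum_(b < n)
       raise2 G (tensor_phi G T Q) a b * lower_index G l 0 b).

End PointwiseAlgebra.

Arguments ctensor R n r : clear implicits.
Arguments mindex n r : clear implicits.

(** * Smooth functions on open subsets of R^n *)

Section Smooth.
Context {R : realType} {n : nat}.

Definition partial_deriv (a : 'I_n) (f : 'rV[R]_n -> R) : 'rV[R]_n -> R :=
  fun y => 'D_(delta_mx 0 a) f y.

Fixpoint Ck_on (m : nat) (U : set 'rV[R]_n) (f : 'rV[R]_n -> R) : Prop :=
  (forall y, U y -> {for y, continuous f}) /\
  if m is m'.+1 then
    forall a : 'I_n,
      (forall y, U y -> derivable f y (delta_mx 0 a)) /\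
      Ck_on m' U (partial_deriv a f)
  else True.

Definition smooth_on (U : set 'rV[R]_n) (f : 'rV[R]_n -> R) : Prop :=
  forall m, Ck_on m U f.

End Smooth.

(** * Manifolds *)

(** [chart_coord] and [point_of] are only meaningful on [chart_dom] and
  [chart_coord @` chart_dom]. *)
Record chart (R : realType) (n : nat) (M : topologicalType) := Chart {
  chart_dom : set M;
  chart_coord : M -> 'rV[R]_n;
  point_of : 'rV[R]_n -> M;
  dom_open : open chart_dom;
  range_open : open (chart_coord @` chart_dom);
  chart_coordK : forall p, chart_dom p -> point_of (chart_coord p) = p;
  coord_cont : forall p, chart_dom p -> {for p, continuous chart_coord};
  point_of_cont : forall y, (chart_coord @` chart_dom) y ->
    {for y, continuous point_of}
}.

Record manifold (R : realType) (n : nat) := Manifold {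
  carrier :> topologicalType;
  carrier_hausdorff : hausdorff_space carrier;
  carrier_second_countable : @second_countable carrier;
  atlas : Type;
  chart_of : atlas -> chart R n carrier;
  atlas_cover : forall p : carrier, exists i, chart_dom (chart_of i) p;
  atlas_smooth : forall (i j : atlas) (a : 'I_n),
    smooth_on
      (chart_coord (chart_of i) @`
         (chart_dom (chart_of i) `&` chart_dom (chart_of j)))
      (fun y => chart_coord (chart_of j) (point_of (chart_of i) y) 0 a)
}.

Section Fields.
Context {R : realType} {n : nat} (M : manifold R n).
Implicit Types (i j : atlas M) (p : M).

Definition in_chart i p : Prop := chart_dom (chart_of i) p.

(** [d f / d x^a] at [p] in the chart [i] *)
Definition dpart i (a : 'I_n) (f : M -> R) (p : M) : R :=
  partial_deriv a (f \o point_of (chart_of i)) (chart_coord (chart_of i) p).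

Definition smooth_in_chart i (f : M -> R) : Prop :=
  smooth_on (chart_coord (chart_of i) @` chart_dom (chart_of i))
            (f \o point_of (chart_of i)).

(** [jac i j p a b = d y^b / d x^a], [x] and [y] being the coordinates of the
  charts [i] and [j]. *)
Definition jac i j p : 'M[R]_n :=
  \matrix_(a < n, b < n) dpart i a (fun q => chart_coord (chart_of j) q 0 b) p.

(** Fields are given by their components in each chart of the atlas (relevant
  only on the domain of the chart), subject to the transformation laws. *)

Record vfield := VField {
  vcomp :> atlas M -> M -> 'rV[R]_n;
  vcomp_smooth : forall i a, smooth_in_chart i (fun p => vcomp i p 0 a);
  vcomp_change : forall i j p, in_chart i p -> in_chart j p ->
    vcomp j p = vcomp i p *m jac i j p
}.

Record tfield (r : nat) := TField {
  tcomp :> atlas M -> M -> ctensor R n r;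
  tcomp_smooth : forall i alpha, smooth_in_chart i (fun p => tcomp i p alpha);
  tcomp_change : forall i j p, in_chart i p -> in_chart j p ->
    forall alpha, tcomp i p alpha =
      \sum_(beta : mindex n r)
        (\prod_(m < r) jac i j p (alpha m) (beta m)) * tcomp j p beta
}.

(** A smooth rank-one subbundle of the tangent bundle: near each point it is
  spanned by a smooth non-vanishing local section [sigma]. *)
Record line_distribution := LineDistribution {
  lcomp :> atlas M -> M -> {vspace 'rV[R]_n};
  lcomp_smooth : forall i p, in_chart i p ->
    exists (V : set 'rV[R]_n) (sigma : 'rV[R]_n -> 'rV[R]_n),
      [/\ open V, V (chart_coord (chart_of i) p),
          V `<=` chart_coord (chart_of i) @` chart_dom (chart_of i),
          forall a, smooth_on V (fun y => sigma y 0 a) &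
          forall y, V y ->
            sigma y != 0 /\ lcomp i (point_of (chart_of i) y) = <[sigma y]>%VS];
  lcomp_change : forall i j p, in_chart i p -> in_chart j p ->
    forall v, (v \in lcomp i p) = (v *m jac i j p \in lcomp j p)
}.

(** An affine connection, through its coefficients
  [christoffel i p a b d = Gamma^d_(ab)], where
  [nabla_(d_a) d_b = Gamma^d_(ab) d_d]. *)
Record connection := Connection {
  christoffel :> atlas M -> M -> 'I_n -> 'I_n -> 'I_n -> R;
  christoffel_smooth : forall i a b d,
    smooth_in_chart i (fun p => christoffel i p a b d);
  christoffel_change : forall i j p, in_chart i p -> in_chart j p ->
    forall a b e,
      \sum_(d < n) christoffel i p a b d * jac i j p d e =
      dpart i a (fun q => jac i j q b e) p +
      \sum_(c < n) \sum_(d < n)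
        jac i j p a c * jac i j p b d * christoffel j p c d e
}.

Definition mupd r (alpha : mindex n r) (m : 'I_r) (d : 'I_n) : mindex n r :=
  [ffun m' => if m' == m then d else alpha m'].

(** [nabla_a T_alpha] *)
Definition cov_tensor (D : connection) r (T : tfield r) i p (a : 'I_n) :
    ctensor R n r :=
  fun alpha => dpart i a (fun q => T i q alpha) p -
    \sum_(m < r) \sum_(d < n) D i p a (alpha m) d * T i p (mupd alpha m d).

(** [nabla_a v^b] *)
Definition cov_vector (D : connection) (v : vfield) i p (a b : 'I_n) : R :=
  dpart i a (fun q => v i q 0 b) p + \sum_(d < n) D i p a d b * v i p 0 d.

(** [X^a nabla_a v^b] *)
Definition cov_along (D : connection) (X v : vfield) i p : 'rV[R]_n :=
  \row_(b < n) \sum_(a < n) X i p 0 a * cov_vector D v i p a b.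

Definition gram (g : tfield 2) i p : 'M[R]_n :=
  \matrix_(a < n, b < n) g i p [ffun m : 'I_2 => if m == 0 then a else b].

Definition lorentzian_metric (g : tfield 2) : Prop :=
  forall i p, in_chart i p -> lorentzian_form (gram g i p).

Definition levi_civita (g : tfield 2) (D : connection) : Prop :=
  forall i p, in_chart i p ->
    (forall a b d, D i p a b d = D i p b a d) /\
    (forall a alpha, cov_tensor D g i p a alpha = 0).

Definition null_congruence (g : tfield 2) (c : line_distribution) : Prop :=
  forall i p, in_chart i p -> null_line (gram g i p) (c i p).

Definition nonvanishing_section (c : line_distribution) (k : vfield) : Prop :=
  forall i p, in_chart i p -> k i p \in c i p /\ k i p != 0.

End Fields.

(* Main.v *)
Require Import Defs.
From mathcomp Require Import all_boot all_order all_algebra.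
From mathcomp Require Import all_classical all_reals all_analysis.
From mathcomp Require Import ring lra zify.

(** The proof replaces null frames by the flag [V > c^perp > c], whose steps
  are given the weights -1, 0 and 1. A tensor [T] has boost order at most [s]
  exactly when it vanishes on vectors whose weights in the flag add up to more
  than [s] ([teval_filtration] is the direction that is needed). Three facts
  follow. Tensors of boost orders [s] and [t] with [s + t < 0] have zero
  contraction ([full_contraction_eq0]). An endomorphism [A] acts on tensors as
  a derivation, and if [A] preserves the flag then this action does not
  increase the boost order; if [A] lowers the flag by one step, the boost
  order grows by one at most ([boost_order_derivation]).

  To differentiate [T], choose endomorphisms [P_y], equal to the identity at
  the base point, that carry the flag there to the flag at [y]. The pullback
  of [T] by [P] has boost order at most [s] along a fixed line, so its
  derivative has it too. In covariant terms: [nabla T + A.T] has boost order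
  at most [s], where [A] is the covariant derivative of [P]
  ([covariant_derivative_boost_order]). Differentiating the conditions on [P]
  gives [A k = nabla k + x k] for some scalar [x], and [g(A v, k) + g(v, nabla
  k) = 0] for [v] in [c^perp]. Only first derivatives of [P] are used, and [P]
  need not be an isometry, so a formula that is polynomial in [g] and [k]
  suffices ([flag_transport]) and no smooth null frame has to be built.

  Let [Q] have boost order at most [- s - 1]. Then [nabla T] and [- A.T] have
  the same contraction with [Q]. With [w = nabla k] and [g(k, l) = 1], the
  rank two endomorphism [B v = g(v,l) w - g(v,w) l] moves the flag as [A]
  does, i.e. [A - B] preserves it, and so [A.T] and [B.T] have the same
  contraction with [Q]. For [B] it is explicit: it is [phi(l, w)], by the
  definition of [phi] ([contraction_rank1], [tensor_phi_form]). Hence the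
  contraction of [nabla T] with [Q] is [phi(w, l)], which is the inner product
  of [nabla k] with the bracket. If [Q] has boost order less than [- s - 1],
  then already [A.T], of boost order at most [s + 1], has zero contraction
  with it. *)

Set Implicit Arguments.
Unset Strict Implicit.
Unset Printing Implicit Defensive.

Import Order.TTheory GRing.Theory Num.Theory.
Import numFieldNormedType.Exports.

Local Open Scope classical_set_scope.
Local Open Scope ring_scope.

(** * Boost weights and the flag of a null line *)

Section Filtration.
Context {R : realType} {n : nat}.
Implicit Types (G E A : 'M[R]_n) (u v w k l : 'rV[R]_n).
Implicit Types (c : {vspace 'rV[R]_n}).

Lemma innerDl G u v w : inner G (u + v) w = inner G u w + inner G v w.
Proof. by rewrite /inner !mulmxDl mxE. Qed.

Lemma innerZl G (x : R) u v : inner G (x *: u) v = x * inner G u v.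
Proof. by rewrite /inner -!scalemxAl mxE. Qed.

Lemma innerBl G u v w : inner G (u - v) w = inner G u w - inner G v w.
Proof. by rewrite -scaleN1r innerDl innerZl mulN1r. Qed.

Lemma inner_sumZl (I : finType) G (x : I -> R) (u : I -> 'rV[R]_n) v :
  inner G (\sum_i x i *: u i) v = \sum_i x i * inner G (u i) v.
Proof.
rewrite /inner !mulmx_suml summxE; apply: eq_bigr => i _.
by rewrite -!scalemxAl [LHS]mxE.
Qed.

Lemma inner_sym G u v : G^T = G -> inner G u v = inner G v u.
Proof.
move=> sG; rewrite /inner.
suff -> : v *m G *m u^T = (u *m G *m v^T)^T by rewrite [RHS]mxE.
by rewrite !trmx_mul trmxK sG mulmxA.
Qed.

Lemma innerDr G u v w : G^T = G ->
  inner G u (v + w) = inner G u v + inner G u w.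
Proof. by move=> sG; rewrite !(inner_sym u) // innerDl. Qed.

Lemma innerZr G (x : R) u v : G^T = G -> inner G u (x *: v) = x * inner G u v.
Proof. by move=> sG; rewrite !(inner_sym u) // innerZl. Qed.

(** The matrix [G *m u^T *m w] is the endomorphism [v |-> g(v,u) w], i.e. the
  tensor [u_a w^b]; every explicit endomorphism below is built from these. *)
Lemma mul_rank1 G u v w : v *m (G *m u^T *m w) = inner G v u *: w.
Proof. by rewrite !mulmxA [_ *m u^T]mx11_scalar mul_scalar_mx. Qed.

Lemma inner_row G E v (a : 'I_n) :
  inner G v (row a E) = (v *m (G *m E^T)) 0 a.
Proof.
rewrite /inner mulmxA [LHS]mxE [RHS]mxE.
by apply: eq_bigr => i _; rewrite [(row a E)^T _ _]mxE !mxE.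
Qed.

Lemma memv_dim1 c k v : \dim c = 1%N -> k \in c -> k != 0 -> v \in c ->
  exists x, v = x *: k.
Proof.
move=> dc kc k0 vc; apply/vlineP.
suff -> : <[k]>%VS = c by [].
by apply/eqP; rewrite eqEdim -memvE kc dim_vline k0 dc.
Qed.

Definition index_weight (a : 'I_n) : int :=
  (a == 0%N :> nat)%:Z - (a == 1%N :> nat)%:Z.

Lemma boost_weightE r (alpha : mindex n r) :
  boost_weight alpha = \sum_j index_weight (alpha j).
Proof.
have card (P : pred 'I_r) : #|[set i | P i]|%:Z = \sum_i (P i)%:Z.
  rewrite -sum1_card big_mkcond (big_morph Posz PoszD (erefl _)) /=.
  apply: eq_bigr => i _; have -> : (i \in [set i | P i]) = P i.
    by apply/idP/idP; rewrite inE.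
  by case: (P i).
by rewrite /boost_weight !card -sumrB.
Qed.

(** The metric has boost weight zero: it pairs weight [z] only with weight
  [-z]. *)
Lemma null_gram_weight (a b : 'I_n) : (null_gram : 'M[R]_n) a b != 0 ->
  index_weight b = - index_weight a.
Proof.
rewrite mxE pnatr_eq0 eqb0 negbK /index_weight.
case: ifP => [a2 /eqP ab|]; last first.
  by move=> a2 /eqP<-; case: (nat_of_ord a) a2 => [|[|]].
have -> : nat_of_ord b = (1 - a)%N by rewrite -ab addKn.
by case: (nat_of_ord a) a2 => [|[|]].
Qed.

Lemma null_gram_sqr : (1 < n)%N ->
  null_gram *m null_gram = 1%:M :> 'M[R]_n.
Proof.
move=> n1; apply/matrixP => a b; rewrite !mxE.
have sl : ((if (a < 2)%N then 1 - a else a)%N < n)%N.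
  by case: ifP => // _; apply: leq_ltn_trans n1; apply: leq_subr.
rewrite (bigD1 (Ordinal sl)) //= big1 => [|d]; last first.
  rewrite -val_eqE /= !mxE => /negPf; case: ifP => a2 dn.
    suff /negPf-> : (a + d != 1)%N by rewrite mul0r.
    by apply/eqP => ad; move: dn; rewrite -ad addKn eqxx.
  by rewrite -val_eqE /= eq_sym dn mul0r.
rewrite !mxE /= addr0 -!val_eqE /=; case: ifP => a2.
  by case: (nat_of_ord a) a2 => [|[|]] //= _; rewrite ?mul1r;
    case: (nat_of_ord b) => [|[|]].
by rewrite a2 eqxx mul1r.
Qed.

(** The flag [V = F^(-1) > F^0 = c^perp > F^1 = c > F^2 = 0], extended to all
  integer weights. It depends on [G] and [c] only, so it gives access to the
  boost order without a null frame. *)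
Definition filtration G c (z : int) v : Prop :=
  [/\ 0 <= z -> perp G c v, 1 <= z -> v \in c & 2 <= z -> v = 0].

Lemma filtrationN G c (z : int) v : z < 0 -> filtration G c z v.
Proof. by move=> z0; split; lia. Qed.

Lemma filtration0 G c v : filtration G c 0 v <-> perp G c v.
Proof. by split=> [[+ _ _]|vp]; [apply|split]. Qed.

Lemma null_line_inner G c u v : G^T = G -> null_line G c ->
  u \in c -> v \in c -> inner G u v = 0.
Proof.
move=> sG [_ nc] uc vc; have := nc _ (rpredD uc vc).
rewrite innerDl !innerDr // !nc // add0r addr0 (inner_sym v) //; lra.
Qed.

Lemma filtration1 G c v : G^T = G -> null_line G c ->
  filtration G c 1 v <-> v \in c.
Proof.
move=> sG nc; split=> [[_ + _]|vc]; first exact.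
by split=> // _ u uc; apply: null_line_inner nc uc vc.
Qed.

Section Frame.
Variables (G E : 'M[R]_n) (c : {vspace 'rV[R]_n}).
Hypotheses (n1 : (1 < n)%N) (sG : G^T = G) (nc : null_line G c).
Hypothesis fE : null_frame G c E.

Lemma inner_frame (a b : 'I_n) :
  inner G (row a E) (row b E) = (null_gram : 'M[R]_n) a b.
Proof. by rewrite inner_row -row_mul mxE mulmxA; case: fE => _ ->. Qed.

Lemma frame_inv : E *m (G *m E^T *m null_gram) = 1%:M.
Proof. by rewrite !mulmxA; case: fE => _ ->; rewrite null_gram_sqr. Qed.

Lemma gram_unit : G \in unitmx.
Proof.
have := frame_inv; rewrite !mulmxA => /mulmx1_unit[+ _].
by rewrite !unitmx_mul => /andP[/andP[]].
Qed.

Lemma invmx_gram : invmx G = E^T *m null_gram *m E.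
Proof.
rewrite -[LHS]mulmx1 -(mulmx1C frame_inv) !mulmxA mulVmx ?mul1mx //.
exact: gram_unit.
Qed.

(** [G *m E^T *m null_gram] is the inverse of [E], so these are the
  coordinates in the frame [E]. *)
Definition coords v : 'rV[R]_n := v *m (G *m E^T *m null_gram).

Lemma coordsK v : coords v *m E = v.
Proof. by rewrite -mulmxA (mulmx1C frame_inv) mulmx1. Qed.

(** Pairing with the frame vector of weight [m] picks out the components of
  weight [-m], which vanish on [F^z] as soon as [-m < z]. *)
Lemma inner_filtration (z : int) v (b : 'I_n) : filtration G c z v ->
  inner G v (row b E) != 0 -> z <= - index_weight b.
Proof.
case=> v0 v1 v2 vb; case: (leP 2 z) => z2.
  by move: vb; rewrite v2 // /inner !mul0mx mxE eqxx.
case: (leP 1 z) => z1.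
  have -> : z = 1 by lia.
  have n0 : (0 < n)%N by apply: ltnW.
  pose o0 := Ordinal n0.
  pose o1 := Ordinal n1.
  have e0 : row o0 E != 0.
    apply/eqP => e; have := inner_frame o0 o1; rewrite e /inner !mul0mx !mxE /=.
    by move/eqP; rewrite eq_sym oner_eq0.
  case: (memv_dim1 nc.1 (fE.1 o0 erefl) e0 (v1 z1)) => x vE.
  move: vb; rewrite vE innerZl inner_frame mulf_eq0 negb_or => /andP[_].
  by move/null_gram_weight => ->.
case: (leP 0 z) => z0; last by rewrite /index_weight; case: eqP; case: eqP; lia.
have -> : z = 0 by lia.
suff b0 : b != 0%N :> nat by rewrite /index_weight (negPf b0); case: eqP.
apply: contra vb => /eqP b0; rewrite inner_sym //.
by apply/eqP/v0 => //; apply: fE.1.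
Qed.

Lemma coords_filtration (z : int) v (b : 'I_n) : filtration G c z v ->
  coords v 0 b != 0 -> z <= index_weight b.
Proof.
move=> vz; rewrite /coords mulmxA mxE.
have [[a]|/forallNP h] := pselect (exists a, (v *m (G *m E^T)) 0 a *
    (null_gram : 'M[R]_n) a b != 0); last first.
  rewrite big1 ?eqxx // => a _.
  by apply/eqP; apply: contra_notT (h a).
rewrite mulf_eq0 negb_or => /andP[va /null_gram_weight ->] _.
by apply: (inner_filtration vz); rewrite inner_row.
Qed.

Lemma teval_coords r (T : ctensor R n r) (v P : 'I_r -> 'rV[R]_n) :
  (forall j, v j = P j *m E) ->
  teval T v = \sum_(beta : mindex n r)
    (\prod_j P j 0 (beta j)) * frame_comp E T beta.
Proof.
move=> vP; rewrite /frame_comp /teval.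
under [RHS]eq_bigr do rewrite big_distrr.
rewrite exchange_big /=; apply: eq_bigr => alpha _.
under eq_bigr do rewrite vP mxE.
rewrite bigA_distr_bigA big_distrr /=; apply: eq_bigr => beta _.
rewrite big_split /= mulrCA; do 2!congr (_ * _).
by apply: eq_bigr => j _; rewrite !mxE.
Qed.

End Frame.

(** The frame-free form of the boost order: expanding each [v j] in a null
  frame where [T] has boost order at most [s] uses only frame vectors of
  weight at least [z j], so every term has total weight greater than [s]. The
  vectors [v j] need not come from a null frame, nor be independent; this is
  what makes it possible to differentiate along a non-orthonormal transport of
  the flag. *)
Lemma teval_filtration G c r (T : ctensor R n r) (s : int) (z : 'I_r -> int)
    (v : 'I_r -> 'rV[R]_n) :
  (1 < n)%N -> G^T = G -> null_line G c -> boost_order_le G c T s ->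
  (forall j, filtration G c (z j) (v j)) ->
  s < \sum_j z j -> teval T v = 0.
Proof.
move=> n1 sG nc [E fE Ts] vz sz.
rewrite (@teval_coords E _ _ _ (fun j => coords G E (v j))); last first.
  by move=> j; rewrite (coordsK n1 fE).
apply: big1 => beta _; apply/eqP; rewrite mulf_eq0.
apply: contraLR sz; rewrite negb_or -leNgt => /andP[Pn0 /Ts].
apply: le_trans; rewrite boost_weightE; apply: ler_sum => j _.
apply: (coords_filtration n1 sG nc fE (vz j)).
by apply: contraNneq Pn0 => e; rewrite (bigD1 j) //= e mul0r.
Qed.

Lemma frame_filtration G c E (a : 'I_n) : (1 < n)%N -> G^T = G ->
  null_line G c -> null_frame G c E -> filtration G c (index_weight a) (row a E).
Proof.
move=> n1 sG nc fE.
case: (leP (index_weight a) (-1)) => [w|wN1]; first by apply: filtrationN; lia.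
case: (eqVneq (index_weight a) 1) => [w|w1].
  rewrite w; apply/filtration1 => //; apply: fE.1.
  by move: w; rewrite /index_weight; case: eqP; case: eqP.
have w0 : index_weight a = 0.
  by move: wN1 w1; rewrite /index_weight; case: eqP => //; case: eqP.
rewrite w0; apply/filtration0 => u uc; apply/eqP/negPn/negP => ua.
have := inner_filtration n1 sG nc fE (_ : filtration G c 1 u) ua.
by rewrite filtration1 // w0 => /(_ uc).
Qed.

End Filtration.

(** * Contractions and derivations of tensors *)

Section Contraction.
Context {R : realType} {n : nat}.
Implicit Types (G E A : 'M[R]_n) (u v w k l : 'rV[R]_n).
Implicit Types (c : {vspace 'rV[R]_n}).

Lemma full_contraction_frame G c E r (T Q : ctensor R n r) :
  (1 < n)%N -> null_frame G c E ->
  full_contraction G T Q =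
  \sum_(gamma : mindex n r) \sum_(delta : mindex n r)
    frame_comp E T gamma * frame_comp E Q delta *
    \prod_j (null_gram : 'M[R]_n) (gamma j) (delta j).
Proof.
move=> n1 fE; rewrite /full_contraction /frame_comp /teval !pair_bigA /=.
under [RHS]eq_bigr do rewrite big_distrlr /= pair_bigA /= big_distrl /=.
rewrite exchange_big /=; apply: eq_bigr => -[alpha beta] _ /=.
rewrite (invmx_gram n1 fE).
under eq_bigr => j _.
  rewrite mxE; under eq_bigr => b _.
    rewrite mxE big_distrl /=; over.
  rewrite exchange_big; over.
rewrite /= bigA_distr_bigA /=.
under eq_bigr do rewrite bigA_distr_bigA /=.
rewrite pair_bigA big_distrr /=; apply: eq_bigr => -[gamma delta] _ /=.
rewrite mulrACA -[RHS]mulrA; congr (_ * _); rewrite -!big_split /=.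
by apply: eq_bigr => j _; rewrite !mxE; ring.
Qed.

(** Contraction pairs a component of weight [m] of [T] only with components of
  weight [-m] of [Q], and these cannot both be within the bounds. *)
Lemma full_contraction_eq0 G c r (T Q : ctensor R n r) (s t : int) :
  (1 < n)%N -> G^T = G -> null_line G c ->
  boost_order_le G c T s -> boost_order_le G c Q t -> s + t < 0 ->
  full_contraction G T Q = 0.
Proof.
move=> n1 sG nc Ts [E fE Qt] st; rewrite (full_contraction_frame _ _ n1 fE).
apply: big1 => gamma _; apply: big1 => delta _; apply/eqP.
rewrite !mulf_eq0; apply: contraLR st; rewrite !negb_or -leNgt.
move=> /andP[/andP[Tg /Qt Qd] N0].
have gd : boost_weight delta = - boost_weight gamma.
  rewrite !boost_weightE -sumrN; apply: eq_bigr => j _.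
  apply: (@null_gram_weight R).
  by apply: contraNneq N0 => e; rewrite (bigD1 j) //= e mul0r.
suff : boost_weight gamma <= s by move: Qd; rewrite gd; lia.
rewrite leNgt; apply: contra Tg; rewrite boost_weightE => sg; apply/eqP.
apply: (teval_filtration n1 sG nc Ts _ sg) => j.
exact: frame_filtration.
Qed.

Lemma full_contractionD G r (T T1 T2 Q : ctensor R n r) :
  (forall alpha, T alpha = T1 alpha + T2 alpha) ->
  full_contraction G T Q = full_contraction G T1 Q + full_contraction G T2 Q.
Proof.
move=> TE; rewrite -big_split; apply: eq_bigr => alpha _ /=.
by rewrite -big_split; apply: eq_bigr => beta _ /=; rewrite TE !mulrDl.
Qed.

(** The derivation of the tensor algebra induced by an endomorphism [A],
  namely the sum over the slots of [T(.., A v, ..)]. The connection terms of a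
  covariant derivative and the derivative of a moving frame are both of this
  form. *)
Definition derivation r A (T : ctensor R n r) : ctensor R n r :=
  fun alpha => \sum_(j < r) \sum_(d < n) A (alpha j) d * T (mupd alpha j d).

Lemma derivationD r A B (T : ctensor R n r) alpha :
  derivation (A + B) T alpha = derivation A T alpha + derivation B T alpha.
Proof.
rewrite -big_split; apply: eq_bigr => j _ /=.
by rewrite -big_split; apply: eq_bigr => d _; rewrite mxE mulrDl.
Qed.

Lemma derivationN r A (T : ctensor R n r) alpha :
  derivation (- A) T alpha = - derivation A T alpha.
Proof.
rewrite -sumrN; apply: eq_bigr => j _ /=.
by rewrite -sumrN; apply: eq_bigr => d _; rewrite mxE mulNr.
Qed.

(** Transposition of a derivation with respect to the pairing of components:
  the index produced by [A] and the index consumed by it are exchanged by the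
  involution [(alpha, d) |-> (mupd alpha j d, alpha j)]. *)
Lemma sum_derivation r A (T : ctensor R n r) (f : mindex n r -> R) :
  \sum_alpha derivation A T alpha * f alpha =
  \sum_(j < r) \sum_alpha
    T alpha * \sum_(e < n) A e (alpha j) * f (mupd alpha j e).
Proof.
rewrite /derivation; under eq_bigr do rewrite big_distrl /=.
rewrite exchange_big /=; apply: eq_bigr => j _.
under eq_bigr do rewrite big_distrl /=.
under [RHS]eq_bigr do rewrite big_distrr /=.
rewrite !pair_bigA /=.
pose h (x : mindex n r * 'I_n) := (mupd x.1 j x.2, x.1 j).
have hK : involutive h.
  move=> [alpha d]; rewrite /h /= ffunE eqxx; congr (_, _).
  by apply/ffunP => i; rewrite !ffunE; case: eqP => // ->.
rewrite (reindex_inj (inv_inj hK)); apply: eq_bigr => -[alpha d] _ /=.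
have [-> _] := hK (alpha, d); rewrite ffunE eqxx; ring.
Qed.

Lemma teval_derivation r A (T : ctensor R n r) (v : 'I_r -> 'rV[R]_n) :
  teval (derivation A T) v =
  \sum_(j < r) teval T (fun i => if i == j then v i *m A else v i).
Proof.
rewrite /teval sum_derivation; apply: eq_bigr => j _; apply: eq_bigr => alpha _.
congr (_ * _); rewrite [RHS](bigD1 j) //= eqxx mxE big_distrl /=.
apply: eq_bigr => e _; rewrite (bigD1 j) //= ffunE eqxx mulrA [A _ _ * _]mulrC.
congr (_ * _); apply: eq_bigr => i /negPf ij.
by rewrite ffunE ij.
Qed.

(** Each term of a derivation changes one vector only, and lowers its place in
  the flag by at most [m]. *)
Lemma boost_order_derivation G c r A (T : ctensor R n r) (s m : int) :
  (1 < n)%N -> G^T = G -> null_line G c ->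
  (forall z v, filtration G c z v -> filtration G c (z - m) (v *m A)) ->
  boost_order_le G c T s -> boost_order_le G c (derivation A T) (s + m).
Proof.
move=> n1 sG nc Am Ts; have [E fE _] := Ts; exists E => // alpha.
apply: contraNle => sa; apply/eqP; rewrite /frame_comp teval_derivation.
apply: big1 => j _.
apply: (teval_filtration n1 sG nc Ts
  (z := fun i => if i == j then index_weight (alpha i) - m
                 else index_weight (alpha i))) => [i|].
  by case: eqP => _; [apply: Am|]; apply: frame_filtration.
rewrite (bigD1 j) //= eqxx (eq_bigr (fun i => index_weight (alpha i))).
  by move: sa; rewrite boost_weightE (bigD1 j) //=; lia.
by move=> i /negPf->.
Qed.

(** The sum over the slots [i] of the contraction of [T(.., v, ..)] with
  [Q(.., w, ..)], [v] and [w] being put in slot [i]; antisymmetrised, it is [-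
  phi(v, w)]. *)
Definition polar_contraction G r (T Q : ctensor R n r) v w : R :=
  \sum_(i < r) \sum_(a < n) \sum_(b < n)
     partial_contraction G i T Q a b * v 0 a * w 0 b.

(** For [A : x |-> g(x,u) w], putting [A x] in slot [i] of [T] yields [g(x,u)
  T(.., w, ..)], and contracting the covector [g(.,u)] with the slot [i] of
  [Q] puts [u] there. *)
Lemma contraction_rank1 G r (T Q : ctensor R n r) u w :
  G^T = G -> G \in unitmx ->
  full_contraction G (derivation (G *m u^T *m w) T) Q =
  polar_contraction G T Q w u.
Proof.
move=> sG uG; rewrite /full_contraction.
under eq_bigr do (under eq_bigr do rewrite -mulrA; rewrite -big_distrr /=).
rewrite sum_derivation; apply: eq_bigr => i _.
transitivity (\sum_(alpha : mindex n r) \sum_(beta : mindex n r)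
   T alpha * Q beta * (\prod_(j < r | j != i) invmx G (alpha j) (beta j)) *
   w 0 (alpha i) * u 0 (beta i)).
  apply: eq_bigr => alpha _; rewrite big_distrr /=.
  under eq_bigr do rewrite big_distrr big_distrr /=.
  rewrite exchange_big /=; apply: eq_bigr => beta _.
  have -> : u 0 (beta i) = \sum_(e < n) (u *m G) 0 e * invmx G e (beta i).
    by rewrite -{1}[u](mulmxK uG) mxE.
  rewrite big_distrr /=; apply: eq_bigr => e _.
  rewrite (bigD1 i) //= ffunE eqxx.
  under eq_bigr => j ji do rewrite ffunE (negPf ji).
  have -> : (u *m G) 0 e = (G *m u^T) e 0.
    by rewrite -{1}sG -[u in LHS]trmxK -trmx_mul mxE.
  by rewrite mxE big_ord1; ring.
rewrite (partition_big (fun alpha : mindex n r => alpha i) xpredT) //=.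
apply: eq_bigr => a _.
under eq_bigr => alpha _ do
  rewrite (partition_big (fun beta : mindex n r => beta i) xpredT) //=.
rewrite exchange_big /=; apply: eq_bigr => b _.
rewrite /partial_contraction !big_distrl /=; apply: eq_bigr => alpha /eqP ia.
rewrite !big_distrl /=; apply: eq_bigr => beta /eqP ib.
by rewrite ia ib.
Qed.

Lemma tensor_phi_form G r (T Q : ctensor R n r) v w :
  (v *m tensor_phi G T Q *m w^T) 0 0 =
  polar_contraction G T Q w v - polar_contraction G T Q v w.
Proof.
rewrite -sumrB mxE.
under eq_bigr do rewrite !mxE big_distrl /=.
rewrite exchange_big /=.
under eq_bigr => a _.
  under eq_bigr => b _ do rewrite !mxE big_distrr big_distrl /=.
  rewrite exchange_big /=; over.
rewrite exchange_big /=; apply: eq_bigr => i _.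
rewrite [X in _ = X - _]exchange_big -sumrB; apply: eq_bigr => a _.
by rewrite -sumrB; apply: eq_bigr => b _; ring.
Qed.

End Contraction.

(** * The contraction formula at a point *)

Section Pointwise.
Context {R : realType} {n : nat}.
Implicit Types (A : 'M[R]_n) (u v w : 'rV[R]_n).
Variables (G : 'M[R]_n) (c : {vspace 'rV[R]_n}) (k : 'rV[R]_n).
Hypotheses (n1 : (1 < n)%N) (sG : G^T = G).
Hypotheses (nc : null_line G c) (kc : k \in c) (k0 : k != 0).

Lemma line_gen v : v \in c -> exists x, v = x *: k.
Proof. exact: memv_dim1 nc.1 kc k0. Qed.

Lemma perp_gen v : perp G c v <-> inner G v k = 0.
Proof.
split=> [vp|vk u /line_gen[x ->]]; first by rewrite inner_sym //; apply: vp.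
by rewrite innerZl inner_sym // vk mulr0.
Qed.

Lemma line_perp v : v \in c -> perp G c v.
Proof. by move=> vc u uc; apply: null_line_inner nc uc vc. Qed.

Lemma filtration_preserved A : k *m A \in c ->
  (forall v, perp G c v -> perp G c (v *m A)) ->
  forall z v, filtration G c z v -> filtration G c (z - 0) (v *m A).
Proof.
move=> kA pA z v [v0 v1 v2]; rewrite subr0; split=> [/v0|/v1|/v2->].
- exact: pA.
- by case/line_gen=> x ->; rewrite -scalemxAl memvZ.
- by rewrite mul0mx.
Qed.

Lemma filtration_lowered A : perp G c (k *m A) ->
  forall z v, filtration G c z v -> filtration G c (z - 1) (v *m A).
Proof.
move=> kA z v [v0 v1 v2]; split=> z1.
- have [x ->] : exists x, v = x *: k by apply/line_gen/v1; lia.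
  apply/perp_gen; rewrite -scalemxAl innerZl.
  by move/perp_gen: kA => ->; rewrite mulr0.
- by rewrite v2 ?mul0mx ?mem0v //; lia.
- by rewrite v2 ?mul0mx //; lia.
Qed.

Variables (l : 'rV[R]_n) (r : nat) (T Q : ctensor R n r) (s : int).
Hypothesis Ts : boost_order_le G c T s.

Let kk : inner G k k = 0. Proof. exact: nc.2. Qed.

(** This says that the vector [phi^ab l_b] lies in [c^perp]. Both terms of
  [phi(k, l)] come from endomorphisms, [v |-> g(v,k) l] and [v |-> g(v,l) k],
  that preserve the flag, so the derivation keeps the boost order of [T]. *)
Lemma tensor_phi_line : G \in unitmx -> boost_order_le G c Q (- s - 1) ->
  (k *m tensor_phi G T Q *m l^T) 0 0 = 0.
Proof.
move=> uG Qs; rewrite tensor_phi_form -!contraction_rank1 //.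
have zero A : k *m A \in c -> (forall v, perp G c v -> perp G c (v *m A)) ->
    full_contraction G (derivation A T) Q = 0.
  move=> kA pA; apply: (full_contraction_eq0 n1 sG nc (s := s + 0) _ Qs).
    apply: (boost_order_derivation n1 sG nc _ Ts).
    exact: filtration_preserved.
  lia.
rewrite !zero ?subr0 // => [|v _||v /perp_gen vk]; rewrite mul_rank1.
- by rewrite memvZ.
- by apply: line_perp; rewrite memvZ.
- by rewrite kk scale0r mem0v.
- by rewrite vk scale0r; apply/perp_gen; rewrite /inner !mul0mx mxE.
Qed.

(** The situation at one point: [N] is the covariant derivative of [T] in some
  direction, [w] that of [k], and [A] the covariant derivative of an
  infinitesimal transport of the flag. The hypothesis [compat] is the
  derivative of the condition that the transport maps [c^perp] to [c^perp]. *)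
Section Covariant.
Variables (N : ctensor R n r) (A : 'M[R]_n) (w : 'rV[R]_n) (x : R).
Hypothesis Ns :
  boost_order_le G c (fun alpha => N alpha + derivation A T alpha) s.
Hypothesis kA : k *m A = w + x *: k.
Hypothesis compat : forall v, inner G v k = 0 ->
  inner G (v *m A) k + inner G v w = 0.

(** The hypothesis [compat] at [v = k] reads [2 g(w,k) = 0], as [A] maps [k]
  to [w] modulo [k]. *)
Lemma inner_deriv_k : inner G w k = 0.
Proof.
have := compat kk; rewrite kA innerDl innerZl kk mulr0 addr0 (inner_sym k) //.
lra.
Qed.

Lemma contraction_derivationE t : boost_order_le G c Q t -> s + t < 0 ->
  full_contraction G N Q = - full_contraction G (derivation A T) Q.
Proof.
move=> Qt st; apply/eqP; rewrite -addr_eq0; apply/eqP.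
rewrite -(@full_contractionD _ _ _ _ (fun a => N a + derivation A T a)) //.
exact: full_contraction_eq0 Ns Qt st.
Qed.

(** Since [k *m A] is orthogonal to [k], the derivation by [A] raises the
  boost order by one at most. *)
Lemma covariant_contraction_lt t : t < - s - 1 ->
  boost_order_le G c Q t -> full_contraction G N Q = 0.
Proof.
move=> ts Qt; rewrite (contraction_derivationE Qt); last by lia.
apply/eqP; rewrite oppr_eq0; apply/eqP.
apply: (full_contraction_eq0 n1 sG nc (s := s + 1) _ Qt); last by lia.
apply: (boost_order_derivation n1 sG nc _ Ts); apply: filtration_lowered.
by apply/perp_gen; rewrite kA innerDl innerZl kk inner_deriv_k mulr0 addr0.
Qed.

(** The antisymmetric endomorphism [B : v |-> g(v,l) w - g(v,w) l] moves the
  flag in the same way as [A], so [A - B] preserves the flag and only [B]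
  contributes to the contraction. *)
Lemma covariant_contraction : G \in unitmx -> inner G k l = 1 ->
  boost_order_le G c Q (- s - 1) ->
  full_contraction G N Q = (w *m tensor_phi G T Q *m l^T) 0 0.
Proof.
move=> uG kl Qs; rewrite (contraction_derivationE Qs); last by lia.
pose B := G *m l^T *m w - G *m w^T *m l.
rewrite tensor_phi_form -!contraction_rank1 //.
rewrite (@full_contractionD _ _ _ _ _ (derivation (A - B) T)
  (derivation B T)); last by move=> a; rewrite -derivationD subrK.
rewrite (@full_contraction_eq0 _ _ G c _ (derivation (A - B) T) Q (s + 0)
  (- s - 1)) //; [|apply: boost_order_derivation => //|lia]; last first.
  have vB v : v *m B = inner G v l *: w - inner G v w *: l.
    by rewrite /B mulmxBr !mul_rank1.
  apply: filtration_preserved => [|v /perp_gen vk].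
    rewrite mulmxBr vB kA kl scale1r (inner_sym k) // inner_deriv_k scale0r.
    by rewrite subr0 addrAC subrr add0r memvZ.
  apply/perp_gen; rewrite mulmxBr vB !innerBl !innerZl inner_deriv_k.
  rewrite (inner_sym l) // kl.
  by have := compat vk; lra.
rewrite add0r (@full_contractionD _ _ _ _ (derivation B T)
   (derivation (G *m l^T *m w) T) (derivation (- (G *m w^T *m l)) T)); last first.
  by move=> a; rewrite -derivationD.
rewrite opprD addrC; congr (_ - _); apply/eqP; rewrite eqr_oppLR; apply/eqP.
rewrite /full_contraction -sumrN; apply: eq_bigr => a _; rewrite -sumrN.
by apply: eq_bigr => b _; rewrite derivationN !mulNr.
Qed.

End Covariant.
End Pointwise.

Section Bracket.
Context {R : realType} {n : nat}.
Implicit Types (u v w : 'rV[R]_n).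
Variables (G : 'M[R]_n) (c : {vspace 'rV[R]_n}) (k : 'rV[R]_n).
Hypotheses (n1 : (1 < n)%N) (sG : G^T = G) (nc : null_line G c).
Hypotheses (kc : k \in c) (k0 : k != 0).

Definition null_dual : 'rV[R]_n :=
  get [set l | inner G l l = 0 /\ inner G k l = 1].

Lemma null_dualP E : null_frame G c E -> inner G k null_dual = 1.
Proof.
move=> fE; suff : [set l | inner G l l = 0 /\ inner G k l = 1] !=set0.
  by case=> l hl; have [] := getPex (ex_intro _ l hl).
pose o0 := Ordinal (ltnW n1); pose o1 := Ordinal n1.
have [x e0] := line_gen nc kc k0 (fE.1 o0 erefl).
have e01 := inner_frame fE o0 o1; rewrite e0 innerZl mxE /= in e01.
exists (x *: row o1 E) => /=; rewrite innerZl !innerZr // e01.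
by rewrite (inner_frame fE) mxE /= !mulr0.
Qed.

Lemma inner_raise2 w l F : G \in unitmx ->
  inner G w (\row_(a < n) \sum_(b < n) raise2 G F a b * lower_index G l 0 b) =
  (w *m F *m l^T) 0 0.
Proof.
move=> uG; rewrite /inner; set b := \row__ _.
have -> : b^T = raise2 G F *m (lower_index G l)^T.
  apply/colP => a; rewrite !mxE; apply: eq_bigr => d _.
  by rewrite [(lower_index _ _)^T _ _]mxE.
rewrite /raise2 /lower_index trmx_mul trmx_inv !mulmxA mulmxK //.
by rewrite sG mulmxKV.
Qed.

(** Changing representatives adds elements of [c], which are orthogonal to
  [c^perp]. *)
Lemma quot_inner_coset v w : perp G c v -> perp G c w ->
  quot_inner G (line_coset c v) (line_coset c w) = inner G v w.
Proof.
move=> vp wp; rewrite /quot_inner.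
have rep u : get (line_coset c u) - u \in c.
  have : line_coset c u !=set0 by exists u; rewrite /line_coset /= subrr mem0v.
  by case=> u' hu'; exact: (getPex (ex_intro _ u' hu')).
suff H a b : a - v \in c -> b - w \in c -> inner G a b = inner G v w.
  exact: H (rep v) (rep w).
move=> av bw; rewrite -(subrK v a) -(subrK w b) innerDl !(innerDr _ (b - w) w sG).
rewrite (null_line_inner sG nc av bw) (wp _ av) (inner_sym v) //.
by rewrite (vp _ bw) !add0r.
Qed.

End Bracket.

(** * Differentiation and transport of the flag *)

Section Derivative.
Context {R : realType} {n : nat}.
Variables (y0 d : 'rV[R]_n).

Lemma is_derive_mulp (f g : 'rV[R]_n -> R) (df dg : R) :
  is_derive y0 d f df -> is_derive y0 d g dg ->
  is_derive y0 d (fun y => f y * g y) (df * g y0 + f y0 * dg).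
Proof.
move=> fd gd; apply: is_derive_eq (is_deriveM fd gd) _.
by rewrite addrC /GRing.scale /= (mulrC df).
Qed.

Lemma is_derive_sump (I : finType) (f : I -> 'rV[R]_n -> R) (df : I -> R) :
  (forall i, is_derive y0 d (f i) (df i)) ->
  is_derive y0 d (fun y => \sum_i f i y) (\sum_i df i).
Proof.
move=> fd; have -> : (fun y => \sum_i f i y) = \sum_i f i.
  by apply/funext => y; rewrite fct_sumE.
by elim/big_ind2 : _ => // [|? ? ? ?]; [exact: is_derive_cst|exact: is_deriveD].
Qed.

Lemma is_derive_prodp r (f : 'I_r -> 'rV[R]_n -> R) (df : 'I_r -> R) :
  (forall i, is_derive y0 d (f i) (df i)) ->
  is_derive y0 d (fun y => \prod_i f i y)
    (\sum_j \prod_i (if i == j then df i else f i y0)).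
Proof.
elim: r f df => [|r IH] f df fd.
  rewrite big_ord0; have -> : (fun y => \prod_(i < 0) f i y) = cst 1.
    by apply/funext => y; rewrite big_ord0.
  exact: is_derive_cst.
have -> : (fun y => \prod_i f i y) =
    (fun y => f ord0 y * \prod_i f (lift ord0 i) y).
  by apply/funext => y; rewrite big_ord_recl.
apply: is_derive_eq (is_derive_mulp (fd ord0) (IH _ _ (fun i => fd _))) _.
rewrite [RHS]big_ord_recl big_ord_recl /=; congr (_ + _).
rewrite big_distrr /=; apply: eq_bigr => j _.
rewrite big_ord_recl /=; congr (_ * _); exact: eq_bigr.
Qed.

Lemma is_derive_near0 (f : 'rV[R]_n -> R) (df : R) :
  (\forall y \near y0, f y = 0) -> is_derive y0 d f df -> df = 0.
Proof.
by move=> f0 /(near_eq_is_derive f0)[_ <-]; have [] := is_derive_cst (0:R) y0 d.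
Qed.

Definition is_derive_mx p q (A : 'rV[R]_n -> 'M[R]_(p, q)) (dA : 'M[R]_(p, q)) :=
  forall i j, is_derive y0 d (fun y => A y i j) (dA i j).

Lemma is_derive_mx_cst p q (A : 'M[R]_(p, q)) : is_derive_mx (cst A) 0.
Proof. by move=> i j; rewrite mxE; exact: is_derive_cst. Qed.

Lemma is_derive_mxD p q (A B : 'rV[R]_n -> 'M[R]_(p, q)) dA dB :
  is_derive_mx A dA -> is_derive_mx B dB ->
  is_derive_mx (fun y => A y + B y) (dA + dB).
Proof.
move=> Ad Bd i j; rewrite mxE.
have -> : (fun y => (A y + B y) i j) = (fun y => A y i j) + (fun y => B y i j).
  by apply/funext => y; rewrite mxE.
exact: is_deriveD.
Qed.

Lemma is_derive_mxN p q (A : 'rV[R]_n -> 'M[R]_(p, q)) dA :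
  is_derive_mx A dA -> is_derive_mx (fun y => - A y) (- dA).
Proof.
move=> Ad i j; rewrite mxE.
have -> : (fun y => (- A y) i j) = - (fun y => A y i j).
  by apply/funext => y; rewrite mxE.
exact: is_deriveN.
Qed.

Lemma is_derive_mxB p q (A B : 'rV[R]_n -> 'M[R]_(p, q)) dA dB :
  is_derive_mx A dA -> is_derive_mx B dB ->
  is_derive_mx (fun y => A y - B y) (dA - dB).
Proof. by move=> Ad Bd; apply: is_derive_mxD => //; apply: is_derive_mxN. Qed.

Lemma is_derive_mxT p q (A : 'rV[R]_n -> 'M[R]_(p, q)) dA :
  is_derive_mx A dA -> is_derive_mx (fun y => (A y)^T) dA^T.
Proof.
move=> Ad i j; rewrite mxE.
by under eq_fun do rewrite mxE; exact: Ad.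
Qed.

Lemma is_derive_mxM p q m (A : 'rV[R]_n -> 'M[R]_(p, q))
    (B : 'rV[R]_n -> 'M[R]_(q, m)) dA dB :
  is_derive_mx A dA -> is_derive_mx B dB ->
  is_derive_mx (fun y => A y *m B y) (dA *m B y0 + A y0 *m dB).
Proof.
move=> Ad Bd i j; under eq_fun do rewrite mxE.
rewrite !mxE -big_split /=; apply: is_derive_sump => h.
exact: is_derive_mulp.
Qed.

Lemma is_derive_mx_near0 p q (A : 'rV[R]_n -> 'M[R]_(p, q)) dA :
  is_derive_mx A dA -> (\forall y \near y0, A y = 0) -> dA = 0.
Proof.
move=> Ad A0; apply/matrixP => i j; rewrite mxE.
apply: is_derive_near0 (Ad i j); near=> y.
by rewrite (_ : A y = 0) ?mxE //; near: y.
Unshelve. all: by end_near. Qed.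

(** The Leibniz rule, in a form that matches [teval_derivation]. *)
Lemma is_derive_teval r (T : 'rV[R]_n -> ctensor R n r) dT
    (v : 'I_r -> 'rV[R]_n -> 'rV[R]_n) dv :
  (forall alpha, is_derive y0 d (fun y => T y alpha) (dT alpha)) ->
  (forall j, is_derive_mx (v j) (dv j)) ->
  is_derive y0 d (fun y => teval (T y) (fun j => v j y))
    (teval dT (fun j => v j y0) +
     \sum_j teval (T y0) (fun i => if i == j then dv i else v i y0)).
Proof.
move=> Td vd; rewrite /teval exchange_big -big_split /=.
apply: is_derive_sump => alpha; rewrite -big_distrr.
apply: is_derive_mulp => //.
apply: is_derive_eq (is_derive_prodp (fun i => vd i 0 (alpha i))) _.
by apply: eq_bigr => j _; apply: eq_bigr => i _; case: eqP.
Qed.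

End Derivative.

Section Transport.
Context {R : realType} {n : nat}.
Variables (y0 d : 'rV[R]_n) (G : 'rV[R]_n -> 'M[R]_n) (dG : 'M[R]_n).
Variables (k : 'rV[R]_n -> 'rV[R]_n) (dk : 'rV[R]_n).
Variables (c : 'rV[R]_n -> {vspace 'rV[R]_n}) (l : 'rV[R]_n).
Hypotheses (n1 : (1 < n)%N) (Gd : is_derive_mx y0 d G dG).
Hypothesis (kd : is_derive_mx y0 d k dk).
Hypothesis flag : \forall y \near y0,
  [/\ (G y)^T = G y, null_line (G y) (c y), k y \in c y & k y != 0].
Hypothesis kl : inner (G y0) (k y0) l = 1.

Let sG : (G y0)^T = G y0. Proof. by case: (nbhs_singleton flag). Qed.
Let nc : null_line (G y0) (c y0). Proof. by case: (nbhs_singleton flag). Qed.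
Let kc : k y0 \in c y0. Proof. by case: (nbhs_singleton flag). Qed.
Let k0 : k y0 != 0. Proof. by case: (nbhs_singleton flag). Qed.

(** Moves [k y0] to [k y]: it is [v |-> v + g0(v,l) (k y - k y0)], with
  [g0(k0,l) = 1]. *)
Definition shear y : 'M[R]_n := 1%:M + G y0 *m l^T *m (k y - k y0).

(** An endomorphism, equal to the identity at [y0], that maps the line [c y0]
  into [c y] and [c^perp] at [y0] into [c^perp] at [y]. The natural formula
  subtracts from the shear a multiple of [l] with denominator [g(l, k y)];
  everything is multiplied by that denominator, which is harmless because the
  flag is invariant under scaling, and leaves an expression polynomial in [G]
  and [k]. *)
Definition flag_transport y : 'M[R]_n :=
  shear y *m (inner (G y) l (k y))%:M -
  (shear y *m G y *m (k y)^T - G y0 *m (k y0)^T) *m l.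

Lemma mul_shear y v :
  v *m shear y = v + inner (G y0) v l *: (k y - k y0).
Proof. by rewrite /shear mulmxDr mulmx1 mul_rank1. Qed.

Lemma mul_flag_transport y v : v *m flag_transport y =
  inner (G y) l (k y) *: (v *m shear y) -
  (inner (G y) (v *m shear y) (k y) - inner (G y0) v (k y0)) *: l.
Proof.
rewrite /flag_transport mulmxBr mulmxA mul_mx_scalar; congr (_ - _).
rewrite mulmxA mulmxBr !mulmxA /inner.
rewrite [X in (X - _) *m _]mx11_scalar [X in (_ - X) *m _]mx11_scalar.
by rewrite mulmxBl !mul_scalar_mx scalerBl.
Qed.

Lemma flag_transport_base : flag_transport y0 = 1%:M.
Proof.
apply/row_matrixP => i; rewrite -[flag_transport _]mul1mx row_mul.
rewrite mul_flag_transport mul_shear subrr scaler0 addr0 subrr scale0r subr0.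
by rewrite (inner_sym l) // kl scale1r.
Qed.

Lemma flag_transport_line : \forall y \near y0,
  k y0 *m flag_transport y = inner (G y) l (k y) *: k y.
Proof.
near=> y.
have [sGy [_ ncy] kcy _] : [/\ (G y)^T = G y, null_line (G y) (c y),
  k y \in c y & k y != 0] by near: y.
have kS : k y0 *m shear y = k y by rewrite mul_shear kl scale1r addrC subrK.
by rewrite mul_flag_transport kS ncy // nc.2 // subrr scale0r subr0.
Unshelve. all: by end_near. Qed.

Lemma flag_transport_perp y v : inner (G y0) v (k y0) = 0 ->
  inner (G y) (v *m flag_transport y) (k y) = 0.
Proof.
move=> vk; rewrite mul_flag_transport vk subr0 innerBl !innerZl mulrC subrr.
by [].
Qed.

Lemma flag_transport_filtration : \forall y \near y0,
  forall z v, filtration (G y0) (c y0) z v ->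
  filtration (G y) (c y) z (v *m flag_transport y).
Proof.
near=> y.
have [sGy ncy kcy k0y] : [/\ (G y)^T = G y, null_line (G y) (c y),
  k y \in c y & k y != 0] by near: y.
have kP : k y0 *m flag_transport y = inner (G y) l (k y) *: k y.
  by near: y; exact: flag_transport_line.
move=> z v [v0 v1 v2]; split=> [/v0|/v1|/v2->].
- move/(perp_gen sG nc kc k0)/flag_transport_perp => vk.
  exact/(perp_gen sGy ncy kcy k0y).
- case/(line_gen nc kc k0) => x ->.
  by rewrite -scalemxAl kP !memvZ.
- by rewrite mul0mx.
Unshelve. all: by end_near. Qed.

Lemma is_derive_flag_transport : exists dP,
  is_derive_mx y0 d flag_transport dP.
Proof.
have shd : is_derive_mx y0 d shear (0 + (0 *m (k y0 - k y0) +
    G y0 *m l^T *m (dk - 0))).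
  apply: is_derive_mxD; first exact: is_derive_mx_cst.
  apply: is_derive_mxM; first exact: is_derive_mx_cst.
  by apply: is_derive_mxB => //; exact: is_derive_mx_cst.
have innd : is_derive_mx y0 d (fun y => (inner (G y) l (k y))%:M : 'M[R]_n)
   (((0 *m G y0 + l *m dG) *m (k y0)^T + l *m G y0 *m dk^T) 0 0)%:M.
  have : is_derive_mx y0 d (fun y => l *m G y *m (k y)^T)
    ((0 *m G y0 + l *m dG) *m (k y0)^T + l *m G y0 *m dk^T).
    apply: is_derive_mxM; last exact: is_derive_mxT.
    by apply: is_derive_mxM => //; exact: is_derive_mx_cst.
  move=> h i j; under eq_fun do rewrite mxE; rewrite mxE.
  case: (i == j); rewrite ?mulr1n ?mulr0n; first exact: h.
  exact: is_derive_cst.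
eexists; apply: is_derive_mxB; first exact: is_derive_mxM shd innd.
apply: is_derive_mxM; last exact: is_derive_mx_cst.
apply: is_derive_mxB; last exact: is_derive_mx_cst.
apply: is_derive_mxM; last exact: is_derive_mxT.
exact: is_derive_mxM.
Qed.

(** Pulled back by the transport, [T y] has boost order at most [s] along the
  fixed line [c y0], which is a linear condition; hence so has its derivative
  at [y0]. The two other conclusions are the derivatives of the properties of
  the transport on [c] and [c^perp]. *)
Lemma transport_derivation r (s : int) (T : 'rV[R]_n -> ctensor R n r) dT :
  (forall alpha, is_derive y0 d (fun y => T y alpha) (dT alpha)) ->
  (\forall y \near y0, boost_order_le (G y) (c y) (T y) s) ->
  exists2 dP : 'M[R]_n,
    boost_order_le (G y0) (c y0)
      (fun alpha => dT alpha + derivation dP (T y0) alpha) s &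
    (exists x, k y0 *m dP = dk + x *: k y0) /\
    (forall v, inner (G y0) v (k y0) = 0 ->
       inner (G y0) (v *m dP) (k y0) + inner dG v (k y0) +
       inner (G y0) v dk = 0).
Proof.
move=> Td Ts; have [dP Pd] := is_derive_flag_transport; exists dP.
  have [E fE _] := nbhs_singleton Ts; exists E => // alpha.
  apply: contraNle; rewrite boost_weightE => sa; apply/eqP.
  have Ed j : is_derive_mx y0 d (fun y => row (alpha j) E *m flag_transport y)
      (row (alpha j) E *m dP).
    have := is_derive_mxM (is_derive_mx_cst _ _ (row (alpha j) E)) Pd.
    by rewrite mul0mx add0r.
  have := is_derive_teval Td Ed; rewrite flag_transport_base.
  move/is_derive_near0 => /(_ _)/esym H.
  rewrite {}H.
    rewrite /frame_comp /teval.
    under eq_bigr do rewrite mulrDl.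
    rewrite big_split /=; congr (_ + _).
      by apply: eq_bigr => b _; under [in RHS]eq_bigr do rewrite mulmx1.
    rewrite -/(teval _ _) teval_derivation; apply: eq_bigr => j _.
    apply: eq_bigr => b _; congr (_ * _); apply: eq_bigr => i _.
    by rewrite mulmx1.
  near=> y.
  have [sGy ncy kcy k0y] : [/\ (G y)^T = G y, null_line (G y) (c y),
    k y \in c y & k y != 0] by near: y.
  apply: (teval_filtration n1 sGy ncy _ _ sa); first by near: y.
  move=> j; have PF : forall z v, filtration (G y0) (c y0) z v ->
    filtration (G y) (c y) z (v *m flag_transport y).
    by near: y; exact: flag_transport_filtration.
  by apply: PF; apply: frame_filtration.
have uPd (u : 'rV[R]_n) :
    is_derive_mx y0 d (fun y => u *m flag_transport y) (u *m dP).
  have := is_derive_mxM (is_derive_mx_cst _ _ u) Pd.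
  by rewrite mul0mx add0r.
split; last first.
  move=> v vk.
  have P0 : \forall y \near y0,
      v *m flag_transport y *m G y *m (k y)^T = 0.
    near=> y; apply/rowP => i; rewrite ord1 [RHS]mxE.
    exact: flag_transport_perp.
  have := is_derive_mxM (is_derive_mxM (uPd v) Gd) (is_derive_mxT kd).
  move/is_derive_mx_near0/(_ P0)/matrixP/(_ 0 0).
  rewrite flag_transport_base mulmx1 mulmxDl.
  rewrite /inner [LHS in LHS = _ -> _]mxE [X in X + _ = _ -> _]mxE.
  by rewrite [X in _ = X -> _]mxE.
have ud : is_derive_mx y0 d (fun y => l *m G y *m (k y)^T)
    ((0 *m G y0 + l *m dG) *m (k y0)^T + l *m G y0 *m dk^T).
  apply: is_derive_mxM; last exact: is_derive_mxT.
  by apply: is_derive_mxM => //; exact: is_derive_mx_cst.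
have := is_derive_mxB (uPd (k y0)) (is_derive_mxM ud kd).
(* [du] is the derivative of the factor [g(l, k)], equal to 1 at [y0], by which
   the transport is rescaled. *)
set du : 'M[R]_1 := (X in X *m k y0 + _).
move/is_derive_mx_near0 => H; exists (du 0 0).
have u1 : l *m G y0 *m (k y0)^T = 1%:M.
  by rewrite [LHS]mx11_scalar -[(_ *m _) 0 0]/(inner _ _ _) inner_sym // kl.
apply/eqP; rewrite addrC -mul_scalar_mx -mx11_scalar -{1}[dk]mul1mx -u1.
rewrite -subr_eq0; apply/eqP/H; near=> y.
have -> : k y0 *m flag_transport y = inner (G y) l (k y) *: k y.
  by near: y; exact: flag_transport_line.
by rewrite /inner -mul_scalar_mx -mx11_scalar subrr.
Unshelve. all: by end_near. Qed.

End Transport.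

(** * Covariant derivatives in a chart *)

Section InChart.
Context {R : realType} {n : nat} (M : manifold R n).
Variables (i : atlas M) (p : M).
Hypothesis ip : in_chart i p.

Let y0 := chart_coord (chart_of i) p.
Let pt := point_of (chart_of i).

Lemma point_of_base : pt y0 = p.
Proof. exact: chart_coordK. Qed.

Lemma near_in_chart : \forall y \near y0, in_chart i (pt y).
Proof.
have : nbhs y0 (chart_coord (chart_of i) @` chart_dom (chart_of i)).
  apply: open_nbhs_nbhs; split; first exact: range_open.
  by exists p.
by apply: filterS => y [q qi <-]; rewrite /pt chart_coordK.
Qed.

Lemma is_derive_dpart a (f : M -> R) : smooth_in_chart i f ->
  is_derive y0 (delta_mx 0 a) (fun y => f (pt y)) (dpart i a f p).
Proof.
move=> /(_ 1%N)[_ /(_ a)[fd _]]; apply: DeriveDef => //.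
by apply: fd; exists p.
Qed.

Definition christoffel_mx (D : connection M) (a : 'I_n) : 'M[R]_n :=
  \matrix_(b, d) D i p a b d.

Definition cov_row (D : connection M) (v : vfield M) (a : 'I_n) : 'rV[R]_n :=
  \row_b cov_vector D v i p a b.

Lemma cov_tensorE D r (T : tfield M r) a alpha :
  cov_tensor D T i p a alpha =
  dpart i a (fun q => T i q alpha) p -
  derivation (christoffel_mx D a) (T i p) alpha.
Proof.
congr (_ - _); apply: eq_bigr => m _; apply: eq_bigr => d _.
by rewrite mxE.
Qed.

Lemma cov_rowE D (v : vfield M) a :
  cov_row D v a =
  \row_b dpart i a (fun q => v i q 0 b) p + v i p *m christoffel_mx D a.
Proof.
apply/rowP => b; rewrite !mxE; congr (_ + _); apply: eq_bigr => d _.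
by rewrite mxE mulrC.
Qed.

Lemma cov_alongE D (X v : vfield M) :
  cov_along D X v i p = \sum_a X i p 0 a *: cov_row D v a.
Proof.
apply/rowP => b; rewrite mxE summxE; apply: eq_bigr => a _.
by rewrite !mxE.
Qed.

(** Metric compatibility, [d_a g = Gamma_a g + g Gamma_a^T]. *)
Lemma gram_derivative (g : tfield M 2) D a : levi_civita g D ->
  \matrix_(b, d) dpart i a (fun q => gram g i q b d) p =
  christoffel_mx D a *m gram g i p + gram g i p *m (christoffel_mx D a)^T.
Proof.
move=> /(_ _ _ ip)[_ gD]; apply/matrixP => b d.
have := gD a [ffun m => if m == 0 then b else d].
rewrite cov_tensorE => /eqP; rewrite subr_eq0 => /eqP H.
rewrite mxE; under eq_fun do rewrite mxE.
rewrite H /derivation big_ord_recl big_ord1 [RHS]mxE; congr (_ + _).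
  rewrite [RHS]mxE; apply: eq_bigr => e _; rewrite !mxE ffunE.
  congr (_ * g _ _ _).
  by apply/ffunP => m; rewrite !ffunE; case: eqP.
rewrite [RHS]mxE; apply: eq_bigr => e _; rewrite !mxE ffunE mulrC.
congr (g _ _ _ * _).
by apply/ffunP => m; rewrite !ffunE; rewrite -!val_eqE /=; case: m => -[|[|]].
Qed.

End InChart.


(** * The contraction formula on the manifold *)

Section CovariantContraction.
Context {R : realType} {n r : nat} (s : int) (M : manifold R n).
Variables (g : tfield M 2) (D : connection M) (c : line_distribution M).
Variables (k : vfield M) (T : tfield M r).
Hypotheses (n1 : (1 < n)%N) (hg : lorentzian_metric g).
Hypotheses (hD : levi_civita g D) (hc : null_congruence g c).
Hypothesis hk : nonvanishing_section c k.
Hypothesis hT : forall (i : atlas M) (p : M), in_chart i p ->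
  boost_order_le (gram g i p) (c i p) (T i p) s.
Variables (i : atlas M) (p : M).
Hypothesis ip : in_chart i p.

Lemma k_null_dual :
  inner (gram g i p) (k i p) (null_dual (gram g i p) (k i p)) = 1.
Proof.
have [E fE _] := hT ip; have [kc k0] := hk ip.
exact: (null_dualP n1 (hg ip).1 (hc ip) kc k0 fE).
Qed.

(** The Christoffel matrix is added to the derivative of the transport of the
  flag: this turns partial derivatives into covariant ones, and compatibility
  with the metric absorbs the derivative of [g]. *)
Lemma covariant_derivative_boost_order a : exists2 A : 'M[R]_n,
  boost_order_le (gram g i p) (c i p)
    (fun alpha => cov_tensor D T i p a alpha + derivation A (T i p) alpha) s &
  (exists x, k i p *m A = cov_row i p D k a + x *: k i p) /\
  (forall v, inner (gram g i p) v (k i p) = 0 ->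
    inner (gram g i p) (v *m A) (k i p) +
    inner (gram g i p) v (cov_row i p D k a) = 0).
Proof.
pose y0 := chart_coord (chart_of i) p.
pose pt := point_of (chart_of i).
have p0 : pt y0 = p := point_of_base ip.
have Gd : is_derive_mx y0 (delta_mx 0 a) (fun y => gram g i (pt y))
    (\matrix_(b, d) dpart i a (fun q => gram g i q b d) p).
  move=> b d; rewrite mxE; apply: (is_derive_dpart ip a).
  by under eq_fun do rewrite mxE; exact: tcomp_smooth.
have kd : is_derive_mx y0 (delta_mx 0 a) (fun y => k i (pt y))
    (\row_b dpart i a (fun q => k i q 0 b) p).
  move=> z b; rewrite ord1 mxE; apply: (is_derive_dpart ip a).
  exact: vcomp_smooth.
have flag : \forall y \near y0, [/\ (gram g i (pt y))^T = gram g i (pt y),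
    null_line (gram g i (pt y)) (c i (pt y)), k i (pt y) \in c i (pt y) &
    k i (pt y) != 0].
  apply: filterS (near_in_chart ip) => y iy; have [kc k0] := hk iy.
  by split=> //; [exact: (hg iy).1|exact: hc].
have Td alpha : is_derive y0 (delta_mx 0 a) (fun y => T i (pt y) alpha)
    (dpart i a (fun q => T i q alpha) p).
  by apply: (is_derive_dpart ip a); exact: tcomp_smooth.
have Ts : \forall y \near y0,
    boost_order_le (gram g i (pt y)) (c i (pt y)) (T i (pt y)) s.
  by apply: filterS (near_in_chart ip) => y; exact: hT.
have kl0 : inner (gram g i (pt y0)) (k i (pt y0))
    (null_dual (gram g i p) (k i p)) = 1 by rewrite p0 k_null_dual.
have [dP dPs [[x kdP] compat]] := transport_derivation n1 Gd kd flag kl0 Td Ts.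
rewrite /= p0 in dPs kdP compat.
exists (dP + christoffel_mx i p D a); last split.
- move: dPs; congr boost_order_le; apply/funext => alpha.
  by rewrite cov_tensorE derivationD [X in _ = _ + X]addrC addrA subrK.
- by exists x; rewrite mulmxDr kdP cov_rowE addrAC.
- have sG := (hg ip).1.
  move=> v vk; rewrite -[RHS](compat v vk) (gram_derivative ip a hD) cov_rowE.
  rewrite mulmxDr innerDl innerDr // /inner.
  rewrite trmx_mul !mulmxDr !mulmxDl !mulmxA [X in _ = _ + X + _]mxE.
  ring.
Qed.

Lemma cov_row_perp a : inner (gram g i p) (cov_row i p D k a) (k i p) = 0.
Proof.
have [A _ [[x kA] compat]] := covariant_derivative_boost_order a.
exact: (inner_deriv_k (hg ip).1 (hc ip) (hk ip).1 kA compat).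
Qed.

Lemma cov_along_perp X : perp (gram g i p) (c i p) (cov_along D X k i p).
Proof.
have [kc k0] := hk ip.
apply/(perp_gen (hg ip).1 (hc ip) kc k0); rewrite cov_alongE.
rewrite inner_sumZl big1 // => a _.
by rewrite cov_row_perp mulr0.
Qed.

Lemma cov_tensor_contraction (Q : ctensor R n r) a :
  boost_order_le (gram g i p) (c i p) Q (- s - 1) ->
  full_contraction (gram g i p) (cov_tensor D T i p a) Q =
  inner (tensor_phi (gram g i p) (T i p) Q) (cov_row i p D k a)
    (null_dual (gram g i p) (k i p)).
Proof.
move=> Qs; have [A As [[x kA] compat]] := covariant_derivative_boost_order a.
have [E fE _] := hT ip; have [kc k0] := hk ip; have sG := (hg ip).1.
exact: (covariant_contraction n1 sG (hc ip) kc k0 (hT ip) As kA compat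
  (gram_unit n1 fE) k_null_dual Qs).
Qed.

Lemma cov_tensor_contraction_lt (Q : ctensor R n r) a :
  boost_order_lt (gram g i p) (c i p) Q (- s - 1) ->
  full_contraction (gram g i p) (cov_tensor D T i p a) Q = 0.
Proof.
case=> t ts Qt.
have [A As [[x kA] compat]] := covariant_derivative_boost_order a.
have [kc k0] := hk ip; have sG := (hg ip).1.
exact: (covariant_contraction_lt n1 sG (hc ip) kc k0 (hT ip)
  As kA compat ts Qt).
Qed.

(** Exhibits a representative of [<T|k|Q>] whose inner products are given by
  [phi]. *)
Lemma bracket_perp (Q : ctensor R n r) :
  boost_order_le (gram g i p) (c i p) Q (- s - 1) ->
  exists2 b, perp (gram g i p) (c i p) b &
    bracket (gram g i p) (c i p) (k i p) (T i p) Q = line_coset (c i p) b /\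
    forall w, inner (gram g i p) w b =
      inner (tensor_phi (gram g i p) (T i p) Q) w
        (null_dual (gram g i p) (k i p)).
Proof.
move=> Qs; have [E fE _] := hT ip; have [kc k0] := hk ip; have sG := (hg ip).1.
have uG := gram_unit n1 fE.
eexists; last split; [|by []|by move=> w; rewrite inner_raise2].
apply/(perp_gen sG (hc ip) kc k0); rewrite inner_sym // inner_raise2 //.
exact: (tensor_phi_line n1 sG (hc ip) kc k0 _ (hT ip) uG Qs).
Qed.

End CovariantContraction.

Theorem theorem1 (R : realType) (n r : nat) (s : int) (M : manifold R n)
    (g : tfield M 2) (D : connection M) (c : line_distribution M)
    (k : vfield M) (T Q : tfield M r)
    (hn : (3 <= n)%N)
    (hg : lorentzian_metric g)
    (hD : levi_civita g D)
    (hc : null_congruence g c)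
    (hk : nonvanishing_section c k)
    (hr : (1 <= r)%N)
    (hs : - r%:Z <= s <= r%:Z - 1)
    (hT : forall (i : atlas M) (p : M), in_chart i p ->
       boost_order (gram g i p) (c i p) (T i p) s)
    (hQ : forall (i : atlas M) (p : M), in_chart i p ->
       boost_order_le (gram g i p) (c i p) (Q i p) (- s - 1)) :
  (forall (X : vfield M) (i : atlas M) (p : M), in_chart i p ->
     [/\ perp (gram g i p) (c i p) (cov_along D X k i p),
         perp_quot (gram g i p) (c i p)
           (bracket (gram g i p) (c i p) (k i p) (T i p) (Q i p)) &
         \sum_(a < n) X i p 0 a *
             full_contraction (gram g i p) (cov_tensor D T i p a) (Q i p) =
         quot_inner (gram g i p)
           (line_coset (c i p) (cov_along D X k i p))
           (bracket (gram g i p) (c i p) (k i p) (T i p) (Q i p))]) /\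
  ((forall (i : atlas M) (p : M), in_chart i p ->
      boost_order_lt (gram g i p) (c i p) (Q i p) (- s - 1)) ->
   forall (i : atlas M) (p : M) (a : 'I_n), in_chart i p ->
     full_contraction (gram g i p) (cov_tensor D T i p a) (Q i p) = 0).
Proof.
have n1 : (1 < n)%N by apply: leq_trans hn.
have Ts i p : in_chart i p ->
    boost_order_le (gram g i p) (c i p) (T i p) s.
  by move=> /hT[E fE [_ Ts]]; exists E.
split=> [X i p ip|Qlt i p a ip]; last first.
  exact: (cov_tensor_contraction_lt n1 hg hD hc hk Ts ip a (Qlt _ _ ip)).
have wp := cov_along_perp n1 hg hD hc hk Ts ip X.
have [b bp [-> bE]] := bracket_perp n1 hg hc hk Ts ip (hQ _ _ ip).
split=> //; first by exists b.
rewrite (quot_inner_coset (hg _ _ ip).1 (hc _ _ ip) wp bp) bE cov_alongE.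
rewrite inner_sumZl; apply: eq_bigr => a _.
by rewrite (cov_tensor_contraction n1 hg hD hc hk Ts ip a (hQ _ _ ip)).
Qed.
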